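(* Let $\Omega\subset\mathbb R^2$ be a periodic rectangle with a conforming Cartesian rectangular mesh $\mathcal T_h$; let $p\ge1$, $m\in\{p-1,p\}$, $\gamma>1$. Suppose that the nodal density and specific internal energy satisfy $\rho_{h,q}>0$ and $e_{h,q}>0$ at all nodes. Define $$s_{h,q}=\log \mathsf p_{h,q}-\gamma\log\rho_{h,q},\quad \mathsf p_{h,q}=(\gamma-1)\rho_{h,q}e_{h,q},\qquad\mathcal S_h=(\rho_hs_h,1)_{V,h},\qquad\mathcal E_{\mathrm{ent},h}=-\frac{\mathcal S_h}{\gamma-1}.$$ (i) For $\rho_h$ fixed in time and fixed $\eta_h|_K=\eta_K\ge0$, along solutions of the semidiscrete magnetic–velocity system (whose internal-energy equation is the Ohmic source $(\rho_h\partial_te_h,v_h)_{V,h}=(\eta_h|\boldsymbol J_h|^2,v_h)_{V,h}$ for all $v_h\in V_h^p$), $$\frac{d\mathcal S_h}{dt}=\sum_{K\in\mathcal T_h}\sum_{x_q\in K}M_q^K\frac{\eta_K|\boldsymbol J_h(x_q)|^2}{e_h(x_q)}\ \ge0 .$$ (ii) One velocity oscillation-elimination (OE) map $(e_h^-,\boldsymbol u_h^-)\mapsto(e_h^+,\boldsymbol u_h^+)$ (with $\rho_h$ unchanged) applied to a state with positive nodal density and internal energy satisfies $$\mathcal S_h^+-\mathcal S_h^-=\sum_{K\in\mathcal T_h}\sum_{x_q\in K}M_q^K\rho_{h,q}\log\Bigl(\frac{e_{h,q}^+}{e_{h,q}^-}\Bigr)\ \ge0 .$$ Consequently neither stabilization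 mechanism decreases the discrete physical entropy $\mathcal S_h$; equivalently, neither increases $\mathcal E_{\mathrm{ent},h}$.
   Context: **Nodes.** Each $K\in\mathcal T_h$ is an axis-parallel rectangle with side lengths $h_{x,K},h_{y,K}$, image of $[-1,1]^2$ under an affine map; $J_K=h_{x,K}h_{y,K}/4$. The nodes $x_q\in K$ are the $(p+1)^2$ tensor-product Gauss–Lobatto–Legendre (GLL) points, with weights $M_q^K=J_K\omega_i\omega_j$ for $q=(i,j)$, $\omega_i$ the $(p+1)$-point GLL weights on $[-1,1]$. $(f,g)_{V,h}=\sum_K\sum_{x_q\in K}M_q^K f_qg_q$ with values taken from inside $K$ (also applied to products of several functions). **Spaces** (periodic; $\mathbb Q^{a,b}(K)$: degree $\le a$ in $x$, $\le b$ in $y$; $\mathbb Q^k=\mathbb Q^{k,k}$). $V_h^k=\{v\in L^2(\Omega):v|_K\in\mathbb Q^k(K)\}$; $W_h^{k+1}=\{w\in H^1(\Omega):w|_K\in\mathbb Q^{k+1}(K)\}$; $N_h^k=\{\boldsymbol g\in H(\mathrm{curl};\Omega):\boldsymbol g|_K\in\mathbb Q^{k,k+1}\times\mathbb Q^{k+1,k}\}$; $R_h^k=\{\boldsymbol r\in H(\mathrm{div};\Omega):\boldsymbol r|_K\in\mathbb Q^{k+1,k}\times\mathbb Q^{k,k+1}\}$. $X_h^p=(V_h^p)^3$, $\mathcal B_h^m=R_h^m\times V_h^m$, $\mathcal A_h^m=N_h^m\times W_h^{m+1}$ (in-plane, out-of-plane components). $\nabla\times\boldsymbol a=(\partial_ya_z,-\partial_xa_z,\partial_xa_y-\partial_ya_x)^T$.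 **Semidiscrete magnetic–velocity system.** Given $\rho_h\in V_h^p$ and $\eta_h\in V_h^0$ fixed in time, find $\boldsymbol u_h(t)\in X_h^p$, $\boldsymbol B_h(t)\in\mathcal B_h^m$, $e_h(t)\in V_h^p$, $\boldsymbol J_h(t),\boldsymbol E_h(t)\in\mathcal A_h^m$ with, for all test functions $\boldsymbol v_h\in X_h^p$, $\boldsymbol C_h\in\mathcal B_h^m$, $v_h\in V_h^p$, $\boldsymbol\chi_h,\boldsymbol G_h\in\mathcal A_h^m$: $(\rho_h\partial_t\boldsymbol u_h,\boldsymbol v_h)_{X,h}=\mathcal C_h(\boldsymbol v_h,\boldsymbol B_h;\boldsymbol J_h)$; $(\partial_t\boldsymbol B_h+\nabla\times\boldsymbol E_h,\boldsymbol C_h)_{\mathcal B,h}=0$; $(\rho_h\partial_te_h,v_h)_{V,h}=(\eta_h|\boldsymbol J_h|^2,v_h)_{V,h}$; $(\boldsymbol J_h,\boldsymbol\chi_h)_{\mathcal A,h}=(\boldsymbol B_h,\nabla\times\boldsymbol\chi_h)_{\mathcal B,h}$; $(\boldsymbol E_h,\boldsymbol G_h)_{\mathcal A,h}=\mathcal C_h(\boldsymbol u_h,\boldsymbol B_h;\boldsymbol G_h)+(\eta_h\boldsymbol J_h\cdot\boldsymbol G_h,1)_{V,h}$. Here $(\rho_h\boldsymbol v,\boldsymbol z)_{X,h}=\sum_d(\rho_hv_d,z_d)_{V,h}$; $(\cdot,\cdot)_{\mathcal B,h}$ is the $L^2(\Omega)$ product on $\mathcal B_h^m$ (realized by exact quadrature);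 $(\boldsymbol F,\boldsymbol G)_{\mathcal A,h}$ is the elementwise tensor quadrature of $F_xG_x+F_yG_y+F_zG_z$ using, with the $(m+1)$-point Gauss–Legendre rule G and the $(m+2)$-point GLL rule L, G in $x$ and L in $y$ for the $x$-component, L in $x$ and G in $y$ for the $y$-component, and L in both for the $z$-component; $\mathcal C_h(\boldsymbol v,\boldsymbol B;\boldsymbol G)=(-\boldsymbol v\times\boldsymbol B,\boldsymbol G)_{\mathcal A,h}$. **Velocity-OE map.** With $(\boldsymbol v,\boldsymbol z)_{\rho,K}=\sum_{x_q\in K}M_q^K\rho_q\boldsymbol v_q\cdot\boldsymbol z_q$, let $P^\rho_{\ell,K}$ be the corresponding orthogonal projection of $[\mathbb Q^p(K)]^3$ onto $[\mathbb Q^\ell(K)]^3$, $P^\rho_{-1,K}=0$, $\boldsymbol w_{\ell,K}=(P^\rho_{\ell,K}-P^\rho_{\ell-1,K})\boldsymbol u_h^-$. At each node of $K$, $$\boldsymbol u_{h,q}^+=(\boldsymbol w_{0,K})_q+\sum_{\ell=1}^p\mathcal D_{\ell,K}(\boldsymbol w_{\ell,K})_q,\qquad e_q^+=e_q^-+\tfrac12\sum_{\ell=1}^p[1-\mathcal D_{\ell,K}^2]|(\boldsymbol w_{\ell,K})_q|^2,$$ $\mathcal D_{\ell,K}=\exp[-s_M\tau\Theta_{\ell,K}]$, $s_M\ge0$, $\tau>0$, $\Theta_{\ell,K}=\sum_{I\in\{x,y\}}\lambda_{M,I,K}\sum_{r=0}^\ell\sigma^u_{r,I,K}$, where, for $\boldsymbol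 u_h=\boldsymbol u_h^-$: $\lambda_{M,I,K}=\frac{2p+1}{h_{I,K}}\max_{x_q\in K}\bigl(|u_{I,h}(x_q)|+|\boldsymbol B_h(x_q)|/\sqrt{\rho_h(x_q)}\bigr)$; $\sigma^u_{r,I,K}=\max_{d\in\{x,y,z\}}\frac{(2r+1)h_{I,K}^r}{2\,r!}\frac{J_{r,I,K}(u_{d,h})}{\Delta^u_{I,K}}$ (a component constant to roundoff contributes zero, in particular when the denominator vanishes); $J_{r,I,K}(w)=\sum_F\bigl(\frac1{|F|}\int_F[\![\partial_I^rw]\!]^2ds\bigr)^{1/2}$ over the two faces $F$ of $K$ normal to direction $I$, $[\![\cdot]\!]$ the jump; $\Delta^u_{I,K}=\max_d\Delta_{I,K}(u_{d,h})$, $\Delta_{I,K}(w)=\max\{\max_{K'\in\mathcal X_{I,K}}\|w-\overline w_{I,K}\|_{L^\infty(K')},10^{-6}\|w-\overline w_\Omega\|_{L^\infty(\Omega)}\}$, with $\mathcal X_{I,K}$ the row/column of elements through $K$ in direction $I$, $\overline w_{I,K}$ the mean of $w$ over it and $\overline w_\Omega$ the mean over $\Omega$. *)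

(* Defs.v *)
From HB Require Import structures.
From mathcomp Require Import all_boot all_order all_algebra.
From mathcomp Require Import all_classical all_reals all_analysis.
Set Implicit Arguments.
Unset Strict Implicit.
Unset Printing Implicit Defensive.
Import Order.TTheory GRing.Theory Num.Theory.
Import numFieldNormedType.Exports.
Local Open Scope classical_set_scope.
Local Open Scope ring_scope.

Definition legendre (R : realType) (n : nat) : {poly R} :=
  (2 ^+ n * n`!%:R)^-1 *: (('X ^+ 2 - 1) ^+ n)^`(n).

Record qrule (R : realType) (n : nat) := QRule {
  qx : 'I_n -> R;
  qw : 'I_n -> R }.

(* n-point Gauss-Legendre rule: nodes are the zeros of P_n, weights
   2 / ((1 - x_i^2) P_n'(x_i)^2). *)
Definition is_GL (R : realType) (n : nat) (Q : qrule R n) : Prop :=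
  [/\ forall i j : 'I_n, (i < j)%N -> qx Q i < qx Q j,
      forall i, root (legendre R n) (qx Q i) &
      forall i, qw Q i =
        2 / ((1 - qx Q i ^+ 2) * (legendre R n)^`().[qx Q i] ^+ 2)].

(* (n+1)-point Gauss-Lobatto-Legendre rule (n >= 1): nodes are the n+1 zeros
   of (1 - x^2) P_n'(x), weights 2 / (n (n+1) P_n(x_i)^2). *)
Definition is_GLL (R : realType) (n : nat) (Q : qrule R n.+1) : Prop :=
  [/\ forall i j : 'I_n.+1, (i < j)%N -> qx Q i < qx Q j,
      forall i, root ((1 - 'X ^+ 2) * (legendre R n)^`()) (qx Q i) &
      forall i, qw Q i =
        2 / ((n * n.+1)%:R * (legendre R n).[qx Q i] ^+ 2)].

(* A conforming mesh of a rectangle by axis-parallel rectangles is a tensor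
   product of two one-dimensional partitions.  Only the values [gx 0 .. gx nx]
   and [gy 0 .. gy ny] of the mesh lines are meaningful. *)
Record mesh (R : realType) := Mesh {
  nx : nat;
  ny : nat;
  gx : nat -> R;
  gy : nat -> R;
  nx_gt0 : (0 < nx)%N;
  ny_gt0 : (0 < ny)%N;
  gx_incr : forall i, (i < nx)%N -> gx i < gx i.+1;
  gy_incr : forall j, (j < ny)%N -> gy j < gy j.+1 }.

Definition elt (R : realType) (M : mesh R) : Type := ('I_(nx M) * 'I_(ny M))%type.

Inductive axis := AX | AY.

Definition other_axis (I : axis) : axis := match I with AX => AY | AY => AX end.

Definition lo (R : realType) (M : mesh R) (I : axis) (K : elt M) : R :=
  match I with AX => gx M K.1 | AY => gy M K.2 end.

Definition hi (R : realType) (M : mesh R) (I : axis) (K : elt M) : R :=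
  match I with AX => gx M K.1.+1 | AY => gy M K.2.+1 end.

Definition hlen (R : realType) (M : mesh R) (I : axis) (K : elt M) : R :=
  hi I K - lo I K.

Definition jac (R : realType) (M : mesh R) (K : elt M) : R :=
  hlen AX K * hlen AY K / 4.

(* Affine image in direction I of the reference coordinate xi in [-1, 1]. *)
Definition ref_map (R : realType) (M : mesh R) (I : axis) (K : elt M) (xi : R) : R :=
  lo I K + (1 + xi) / 2 * hlen I K.

(* Periodic neighbours; [ordS] and [ord_pred] are cyclic. *)
Definition nbr_next (R : realType) (M : mesh R) (I : axis) (K : elt M) : elt M :=
  match I with AX => (ordS K.1, K.2) | AY => (K.1, ordS K.2) end.

Definition nbr_prev (R : realType) (M : mesh R) (I : axis) (K : elt M) : elt M :=
  match I with AX => (ord_pred K.1, K.2) | AY => (K.1, ord_pred K.2) end.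

(* K' belongs to the row (I = AX) or column (I = AY) of elements through K. *)
Definition in_strip (R : realType) (M : mesh R) (I : axis) (K K' : elt M) : bool :=
  match I with AX => K'.2 == K.2 | AY => K'.1 == K.1 end.

(* [f K x y] is the value at the physical point (x, y) taken from inside K.
   Each [f K] is given on the whole plane (for the discrete spaces, by polynomial
   extension), so that traces and derivatives on the boundary of K
   are ordinary values and derivatives of [f K]. *)
Definition field (R : realType) (M : mesh R) : Type := elt M -> R -> R -> R.

Definition vfield (R : realType) (M : mesh R) : Type := 'I_3 -> field M.

Definition cx : 'I_3 := @Ordinal 3 0 isT.
Definition cy : 'I_3 := @Ordinal 3 1 isT.
Definition cz : 'I_3 := @Ordinal 3 2 isT.

Definition comp_of (I : axis) : 'I_3 := match I with AX => cx | AY => cy end.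

Definition vec3 (T : Type) (a b c : T) : 'I_3 -> T :=
  fun d => nth a [:: a; b; c] d.

Definition mulf (R : realType) (M : mesh R) (f g : field M) : field M :=
  fun K x y => f K x y * g K x y.

Definition addf (R : realType) (M : mesh R) (f g : field M) : field M :=
  fun K x y => f K x y + g K x y.

Definition oppf (R : realType) (M : mesh R) (f : field M) : field M :=
  fun K x y => - f K x y.

Definition constf (R : realType) (M : mesh R) (a : elt M -> R) : field M :=
  fun K _ _ => a K.

Definition dotf (R : realType) (M : mesh R) (F G : vfield M) : field M :=
  fun K x y => \sum_(d < 3) F d K x y * G d K x y.

Definition normf (R : realType) (M : mesh R) (F : vfield M) : field M :=
  fun K x y => Num.sqrt (dotf F F K x y).

Definition crossf (R : realType) (M : mesh R) (v B : vfield M) : vfield M :=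
  vec3 (addf (mulf (v cy) (B cz)) (oppf (mulf (v cz) (B cy))))
       (addf (mulf (v cz) (B cx)) (oppf (mulf (v cx) (B cz))))
       (addf (mulf (v cx) (B cy)) (oppf (mulf (v cy) (B cx)))).

Definition pd (R : realType) (I : axis) (r : nat) (f : R -> R -> R) : R -> R -> R :=
  match I with
  | AX => fun x y => derive1n r (fun s => f s y) x
  | AY => fun x y => derive1n r (fun s => f x s) y
  end.

Definition pdf (R : realType) (M : mesh R) (I : axis) (f : field M) : field M :=
  fun K => pd I 1 (f K).

Definition curlf (R : realType) (M : mesh R) (a : vfield M) : vfield M :=
  vec3 (pdf AY (a cz))
       (oppf (pdf AX (a cz)))
       (addf (pdf AX (a cy)) (oppf (pdf AY (a cx)))).

Definition integral2 (R : realType) (A : set (R * R)) (f : R -> R -> R) : R :=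
  Rintegral (lebesgue_measure \x lebesgue_measure)%E A (fun z => f z.1 z.2).

Definition cell (R : realType) (M : mesh R) (K : elt M) : set (R * R) :=
  `[lo AX K, hi AX K] `*` `[lo AY K, hi AY K].

Definition Omega (R : realType) (M : mesh R) : set (R * R) :=
  `[gx M 0%N, gx M (nx M)] `*` `[gy M 0%N, gy M (ny M)].

Definition int_elts (R : realType) (M : mesh R) (f : field M) : R :=
  \sum_(K : elt M) integral2 (cell K) (f K).

(* [D i j] is the mixed partial derivative of order i in x and j in y. *)
Definition smooth2 (R : realType) (phi : R -> R -> R) : Prop :=
  exists D : nat -> nat -> R -> R -> R,
    D 0%N 0%N = phi /\
    forall i j,
      continuous (fun z : R * R => D i j z.1 z.2) /\
      forall x y : R,
        is_derive x (1 : R) (fun s => D i j s y) (D i.+1 j x y) /\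
        is_derive y (1 : R) (fun s => D i j x s) (D i j.+1 x y).

Definition periodic_test (R : realType) (M : mesh R) (phi : R -> R -> R) : Prop :=
  [/\ smooth2 phi,
      forall x y, phi (x + (gx M (nx M) - gx M 0%N)) y = phi x y &
      forall x y, phi x (y + (gy M (ny M) - gy M 0%N)) = phi x y].

Definition in_L2 (R : realType) (M : mesh R) (g : R -> R -> R) : Prop :=
  measurable_fun (Omega M) (fun z : R * R => g z.1 z.2) /\
  (lebesgue_measure \x lebesgue_measure)%E.-integrable (Omega M)
    (fun z : R * R => (g z.1 z.2 ^+ 2)%:E).

(* The integral over Omega of f * psi, f piecewise defined, psi global. *)
Definition pair_elts (R : realType) (M : mesh R) (f : field M) (psi : R -> R -> R) : R :=
  int_elts (mulf f (fun _ => psi)).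

Definition pair_glob (R : realType) (M : mesh R) (g psi : R -> R -> R) : R :=
  integral2 (Omega M) (fun x y => g x y * psi x y).

Definition in_H1 (R : realType) (M : mesh R) (w : field M) : Prop :=
  forall I : axis, exists2 g, in_L2 M g &
    forall phi, periodic_test M phi ->
      pair_elts w (pd I 1 phi) = - pair_glob M g phi.

Definition in_Hcurl (R : realType) (M : mesh R) (ax ay : field M) : Prop :=
  exists2 c, in_L2 M c &
    forall phi, periodic_test M phi ->
      pair_elts ax (pd AY 1 phi) - pair_elts ay (pd AX 1 phi) = pair_glob M c phi.

Definition in_Hdiv (R : realType) (M : mesh R) (rx ry : field M) : Prop :=
  exists2 c, in_L2 M c &
    forall phi, periodic_test M phi ->
      pair_elts rx (pd AX 1 phi) + pair_elts ry (pd AY 1 phi) = - pair_glob M c phi.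

Definition is_Q (R : realType) (a b : nat) (f : R -> R -> R) : Prop :=
  exists c : 'M[R]_(a.+1, b.+1), forall x y,
    f x y = \sum_i \sum_j c i j * x ^+ i * y ^+ j.

Definition elt_Q (R : realType) (M : mesh R) (a b : nat) (f : field M) : Prop :=
  forall K, is_Q a b (f K).

(* Piecewise polynomials are square integrable, so membership in L^2(Omega) is
   not repeated. *)
Definition in_V (R : realType) (M : mesh R) (k : nat) (v : field M) : Prop :=
  elt_Q k k v.

(* [in_W k] is W_h^k; the space paired with N_h^k is [in_W k.+1]. *)
Definition in_W (R : realType) (M : mesh R) (k : nat) (w : field M) : Prop :=
  in_H1 w /\ elt_Q k k w.

Definition in_N (R : realType) (M : mesh R) (k : nat) (ax ay : field M) : Prop :=
  [/\ in_Hcurl ax ay, elt_Q k k.+1 ax & elt_Q k.+1 k ay].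

Definition in_R (R : realType) (M : mesh R) (k : nat) (rx ry : field M) : Prop :=
  [/\ in_Hdiv rx ry, elt_Q k.+1 k rx & elt_Q k k.+1 ry].

Definition in_X (R : realType) (M : mesh R) (p : nat) (u : vfield M) : Prop :=
  forall d, in_V p (u d).

Definition in_B (R : realType) (M : mesh R) (m : nat) (B : vfield M) : Prop :=
  in_R m (B cx) (B cy) /\ in_V m (B cz).

Definition in_A (R : realType) (M : mesh R) (m : nat) (a : vfield M) : Prop :=
  in_N m (a cx) (a cy) /\ in_W m.+1 (a cz).

Definition node (R : realType) (M : mesh R) (n : nat) (Q : qrule R n)
    (I : axis) (K : elt M) (i : 'I_n) : R :=
  ref_map I K (qx Q i).

Definition nweight (R : realType) (M : mesh R) (n1 n2 : nat)
    (Q1 : qrule R n1) (Q2 : qrule R n2) (K : elt M) (q : 'I_n1 * 'I_n2) : R :=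
  jac K * qw Q1 q.1 * qw Q2 q.2.

(* Value at the tensor-product node q of K, taken from inside K. *)
Definition nval (R : realType) (M : mesh R) (n1 n2 : nat)
    (Q1 : qrule R n1) (Q2 : qrule R n2) (f : field M) (K : elt M)
    (q : 'I_n1 * 'I_n2) : R :=
  f K (node Q1 AX K q.1) (node Q2 AY K q.2).

Definition tquad (R : realType) (M : mesh R) (n1 n2 : nat)
    (Q1 : qrule R n1) (Q2 : qrule R n2) (f : field M) : R :=
  \sum_(K : elt M) \sum_(q : 'I_n1 * 'I_n2)
    nweight Q1 Q2 K q * nval Q1 Q2 f K q.

Definition ipV (R : realType) (M : mesh R) (n : nat) (L : qrule R n)
    (f g : field M) : R :=
  tquad L L (mulf f g).

(* ipX rho v z is (rho v, z)_{X,h}. *)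
Definition ipX (R : realType) (M : mesh R) (n : nat) (L : qrule R n)
    (rho : field M) (v z : vfield M) : R :=
  \sum_(d < 3) ipV L (mulf rho (v d)) (z d).

Definition ipB (R : realType) (M : mesh R) (B C : vfield M) : R :=
  int_elts (dotf B C).

Definition ipA (R : realType) (M : mesh R) (m : nat)
    (G : qrule R m.+1) (L : qrule R m.+2) (E F : vfield M) : R :=
  tquad G L (mulf (E cx) (F cx)) + tquad L G (mulf (E cy) (F cy))
  + tquad L L (mulf (E cz) (F cz)).

Definition formC (R : realType) (M : mesh R) (m : nat)
    (G : qrule R m.+1) (L : qrule R m.+2) (v B F : vfield M) : R :=
  ipA G L (fun d => oppf (crossf v B d)) F.

Definition t_derivable (R : realType) (M : mesh R) (f : R -> field M) (t : R) : Prop :=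
  forall K x y, derivable (fun s : R => f s K x y) t 1.

Definition dt (R : realType) (M : mesh R) (f : R -> field M) (t : R) : field M :=
  fun K x y => derive1 (fun s : R => f s K x y) t.

Definition dtv (R : realType) (M : mesh R) (f : R -> vfield M) (t : R) : vfield M :=
  fun d => dt (fun s => f s d) t.

Record mv_system (R : realType) (M : mesh R) (p m : nat)
    (Lp : qrule R p.+1) (Gm : qrule R m.+1) (Lm : qrule R m.+2)
    (rho eta : field M) (u B : R -> vfield M) (e : R -> field M)
    (J E : R -> vfield M) (t : R) : Prop := MVSystem {
  mv_u : in_X p (u t);
  mv_B : in_B m (B t);
  mv_e : in_V p (e t);
  mv_J : in_A m (J t);
  mv_E : in_A m (E t);
  mv_du : forall d, t_derivable (fun s => u s d) t;
  mv_dB : forall d, t_derivable (fun s => B s d) t;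
  mv_de : t_derivable e t;
  mv_momentum : forall v, in_X p v ->
    ipX Lp rho (dtv u t) v = formC Gm Lm v (B t) (J t);
  mv_faraday : forall C, in_B m C ->
    ipB (fun d => addf (dtv B t d) (curlf (E t) d)) C = 0;
  mv_energy : forall v, in_V p v ->
    ipV Lp (mulf rho (dt e t)) v = ipV Lp (mulf eta (dotf (J t) (J t))) v;
  mv_current : forall chi, in_A m chi ->
    ipA Gm Lm (J t) chi = ipB (B t) (curlf chi);
  mv_ohm : forall G, in_A m G ->
    ipA Gm Lm (E t) G = formC Gm Lm (u t) (B t) G
      + ipV Lp (mulf eta (dotf (J t) G)) (constf (fun _ => 1)) }.

Definition lvec (R : realType) : Type := 'I_3 -> R -> R -> R.

Definition on_elt (R : realType) (M : mesh R) (u : vfield M) (K : elt M) : lvec R :=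
  fun d => u d K.

Definition in_Q3 (R : realType) (l : nat) (v : lvec R) : Prop :=
  forall d, is_Q l l (v d).

Definition ip_rho (R : realType) (M : mesh R) (n : nat) (L : qrule R n)
    (rho : field M) (K : elt M) (v z : lvec R) : R :=
  \sum_(q : 'I_n * 'I_n) nweight L L K q * nval L L rho K q *
    \sum_(d < 3) v d (node L AX K q.1) (node L AY K q.2)
               * z d (node L AX K q.1) (node L AY K q.2).

(* The rho-orthogonal projection of v onto [Q^l(K)]^3. *)
Definition proj_rho (R : realType) (M : mesh R) (n : nat) (L : qrule R n)
    (rho : field M) (K : elt M) (l : nat) (v : lvec R) : lvec R :=
  xget (fun _ _ _ => 0) [set w : lvec R | in_Q3 l w /\
    forall z, in_Q3 l z ->
      ip_rho L rho K (fun d x y => v d x y - w d x y) z = 0].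

(* w_l = (P_l - P_{l-1}) u, with P_{-1} = 0. *)
Definition modal (R : realType) (M : mesh R) (n : nat) (L : qrule R n)
    (rho : field M) (u : vfield M) (l : nat) : vfield M :=
  fun d K x y =>
    proj_rho L rho K l (on_elt u K) d x y
    - (if l is l'.+1 then proj_rho L rho K l' (on_elt u K) d x y else 0).

(* lambda_{M,I,K}; the maximized quantities are nonnegative, so 0 is a neutral
   starting value (same remark for the maxima below). *)
Definition lambdaM (R : realType) (M : mesh R) (p : nat) (L : qrule R p.+1)
    (rho : field M) (u B : vfield M) (I : axis) (K : elt M) : R :=
  (2 * p + 1)%:R / hlen I K *
  \big[Num.max/0]_(q : 'I_p.+1 * 'I_p.+1)
    (`|nval L L (u (comp_of I)) K q|
     + nval L L (normf B) K q / Num.sqrt (nval L L rho K q)).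

(* Trace on the line normal to direction I at coordinate c, as a function of
   the tangential coordinate. *)
Definition line_trace (R : realType) (I : axis) (c : R) (f : R -> R -> R) : R -> R :=
  fun s => match I with AX => f c s | AY => f s c end.

(* Jump of d_I^r w across the face between K and its neighbour nbr_next I K, as a
   function of the tangential coordinate. *)
Definition face_jump (R : realType) (M : mesh R) (I : axis) (r : nat) (w : field M)
    (K : elt M) : R -> R :=
  fun s => line_trace I (lo I (nbr_next I K)) (pd I r (w (nbr_next I K))) s
           - line_trace I (hi I K) (pd I r (w K)) s.

Definition face_rms (R : realType) (M : mesh R) (I : axis) (K : elt M)
    (f : R -> R) : R :=
  Num.sqrt ((hlen (other_axis I) K)^-1 *
    Rintegral lebesgue_measure `[lo (other_axis I) K, hi (other_axis I) K]
      (fun s => f s ^+ 2)).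

(* J_{r,I,K}(w): the faces of K normal to I separate nbr_prev I K from K and K from
   nbr_next I K. *)
Definition jumpJ (R : realType) (M : mesh R) (I : axis) (r : nat) (w : field M)
    (K : elt M) : R :=
  face_rms I K (face_jump I r w (nbr_prev I K)) + face_rms I K (face_jump I r w K).

Definition mean_over (R : realType) (M : mesh R) (P : pred (elt M)) (w : field M) : R :=
  (\sum_(K | P K) integral2 (cell K) (w K)) /
  (\sum_(K | P K) hlen AX K * hlen AY K).

(* L^infinity(K) norm of w - c; for w K continuous it is a plain supremum. *)
Definition dev_sup (R : realType) (M : mesh R) (w : field M) (c : R) (K : elt M) : R :=
  sup [set `|w K z.1 z.2 - c| | z in cell K].

Definition devmax (R : realType) (M : mesh R) (I : axis) (K : elt M) (w : field M) : R :=
  Num.max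
    (\big[Num.max/0]_(K' | in_strip I K K')
        dev_sup w (mean_over (in_strip I K) w) K')
    (10 ^- 6 * \big[Num.max/0]_(K' : elt M) dev_sup w (mean_over predT w) K').

Definition devmaxu (R : realType) (M : mesh R) (I : axis) (K : elt M) (u : vfield M) : R :=
  \big[Num.max/0]_(d < 3) devmax I K (u d).

(* [skip I K w]: the component w is treated as constant to roundoff in the
   evaluation of sigma on K in direction I, and then contributes zero.  The
   tolerance is not fixed; the criterion only has to apply when the
   denominator vanishes. *)
Definition skip_rule (R : realType) (M : mesh R)
    (skip : axis -> elt M -> field M -> bool) : Prop :=
  forall I K (u : vfield M), devmaxu I K u = 0 -> forall d, skip I K (u d).

Definition sigmau (R : realType) (M : mesh R)
    (skip : axis -> elt M -> field M -> bool) (r : nat) (I : axis) (K : elt M)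
    (u : vfield M) : R :=
  \big[Num.max/0]_(d < 3)
    (if skip I K (u d) then 0
     else (2 * r + 1)%:R * hlen I K ^+ r / (2 * r`!%:R)
          * (jumpJ I r (u d) K / devmaxu I K u)).

Definition Theta (R : realType) (M : mesh R) (p : nat) (L : qrule R p.+1)
    (skip : axis -> elt M -> field M -> bool) (rho : field M) (u B : vfield M)
    (l : nat) (K : elt M) : R :=
  lambdaM L rho u B AX K * \sum_(r < l.+1) sigmau skip r AX K u
  + lambdaM L rho u B AY K * \sum_(r < l.+1) sigmau skip r AY K u.

Definition damping (R : realType) (M : mesh R) (p : nat) (L : qrule R p.+1)
    (skip : axis -> elt M -> field M -> bool) (sM tau : R) (rho : field M)
    (u B : vfield M) (l : nat) (K : elt M) : R :=
  expR (- (sM * tau * Theta L skip rho u B l K)).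

(* (ep, up) is the image of (em, um): both are in the discrete spaces, hence
   determined by the prescribed nodal values. *)
Record velocity_OE (R : realType) (M : mesh R) (p : nat) (L : qrule R p.+1)
    (skip : axis -> elt M -> field M -> bool) (sM tau : R) (rho : field M)
    (B : vfield M) (em : field M) (um : vfield M) (ep : field M) (up : vfield M)
    : Prop := VelocityOE {
  oe_up : in_X p up;
  oe_ep : in_V p ep;
  oe_velocity : forall K q d,
    nval L L (up d) K q =
      nval L L (modal L rho um 0 d) K q
      + \sum_(1 <= l < p.+1)
          damping L skip sM tau rho um B l K * nval L L (modal L rho um l d) K q;
  oe_energy : forall K q,
    nval L L ep K q =
      nval L L em K q
      + 2^-1 * \sum_(1 <= l < p.+1)
          (1 - damping L skip sM tau rho um B l K ^+ 2)
          * nval L L (normf (modal L rho um l)) K q ^+ 2 }.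

Definition pressure (R : realType) (M : mesh R) (gamma : R) (rho e : field M) : field M :=
  fun K x y => (gamma - 1) * rho K x y * e K x y.

Definition entropy (R : realType) (M : mesh R) (gamma : R) (rho e : field M) : field M :=
  fun K x y => ln (pressure gamma rho e K x y) - gamma * ln (rho K x y).

Definition entS (R : realType) (M : mesh R) (n : nat) (L : qrule R n) (gamma : R)
    (rho e : field M) : R :=
  ipV L (mulf rho (entropy gamma rho e)) (constf (fun _ => 1)).

Definition entE (R : realType) (M : mesh R) (n : nat) (L : qrule R n) (gamma : R)
    (rho e : field M) : R :=
  - entS L gamma rho e / (gamma - 1).

Definition nodal_pos (R : realType) (M : mesh R) (n : nat) (L : qrule R n)
    (f : field M) : Prop :=
  forall K q, 0 < nval L L f K q.

(* Main.v *)
(** Testing the internal-energy equation with the element of [V_h^p] that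
    interpolates [1 / e_h] at the GLL nodes gives the entropy production, since
    [rho_h] is fixed and the nodal entropy is [log e_h] up to a constant.  The
    velocity-OE map never lowers a nodal internal energy, because every damping
    factor lies in [0, 1]; so the entropy gain is a nonnegative combination of
    logarithms of ratios that are at least one. *)
Require Import Defs.
From HB Require Import structures.
From mathcomp Require Import all_boot all_order all_algebra.
From mathcomp Require Import all_classical all_reals all_analysis.
Set Implicit Arguments.
Unset Strict Implicit.
Unset Printing Implicit Defensive.
Import Order.TTheory GRing.Theory Num.Theory.
Import numFieldNormedType.Exports.
Local Open Scope classical_set_scope.
Local Open Scope ring_scope.

(** * Derivatives of sums and logarithms, and monotonicity *)

Lemma is_derive_bigsum (R : numFieldType) (V W : normedModType R) (I : Type)
    (r : seq I) (h : I -> V -> W) (x v : V) (dh : I -> W) :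
  (forall i, is_derive x v (h i) (dh i)) ->
  is_derive x v (fun z => \sum_(i <- r) h i z) (\sum_(i <- r) dh i).
Proof.
move=> hh; rewrite (_ : (fun z => _) = \sum_(i <- r) h i); last first.
  by apply/funext => z; rewrite fct_sumE.
by elim/big_ind2 : _ => // *; [exact: is_derive_cst|exact: is_deriveD].
Qed.

(** A constant factor adds a constant to the logarithm, so it drops out of the derivative. Here [c]
    stands for the time-independent factor (gamma - 1) rho in the nodal pressure. *)
Lemma is_derive_ln_scale (R : realType) (c : R) (f : R -> R) (t df : R) :
  0 < c -> 0 < f t -> is_derive t (1 : R) f df ->
  is_derive t (1 : R) (fun s => ln (c * f s)) (df / f t).
Proof.
move=> c0 ft0 fdf.
have cdf : is_derive t (1 : R) (fun s => c * f s) (c * df).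
  exact: (is_deriveZ c fdf).
have lnf := @is_derive1_comp _ _ (fun s => c * f s) _ _ _
  (is_derive1_ln (mulr_gt0 c0 ft0)) cdf.
apply: (is_derive_eq lnf).
by rewrite invfM mulrACA mulVf ?mul1r 1?mulrC// gt_eqF.
Qed.

(** Turns the sign of the entropy production into monotonicity in time. The interval is open because
    the system is posed on an open time interval. *)
Lemma is_derive_ge0_homo (R : realType) (f df : R -> R) (a b : R) :
  (forall x, a < x < b -> is_derive x (1 : R) f (df x)) ->
  (forall x, a < x < b -> 0 <= df x) ->
  forall x y, a < x < b -> a < y < b -> x <= y -> f x <= f y.
Proof.
move=> fdf df0 x y xab yab xy.
have dfx z : z \in `]a, b[%R -> is_derive z (1 : R) f (df z).
  by rewrite in_itv/= => /fdf.
apply: (@ger0_derive1_le_oo _ f a b) => //; try by rewrite in_itv.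
- by move=> z /dfx [].
- move=> z zab; have := dfx z zab => fz.
  by rewrite derive1E derive_val df0//; move: zab; rewrite in_itv.
- move=> z; rewrite inE/= => zab.
  by apply: differentiable_continuous; apply/derivable1_diffP; case: (dfx z zab).
Qed.

(** * Interpolation at tensor-product nodes *)

Lemma Vandermonde_unitmx (F : fieldType) (n : nat) (a : 'rV[F]_n) :
  injective (a 0) -> Vandermonde n a \in unitmx.
Proof.
move=> a_inj; rewrite unitmxE det_Vandermonde unitfE.
apply/prodf_neq0 => i _; apply/prodf_neq0 => j ij.
rewrite subr_eq0; apply/eqP => /a_inj ji.
by rewrite ji ltnn in ij.
Qed.

Lemma is_Q_interpolation (R : realType) (n : nat) (x y : 'I_n.+1 -> R)
    (c : 'I_n.+1 * 'I_n.+1 -> R) :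
  injective x -> injective y ->
  exists f, is_Q n n f /\ forall q, f (x q.1) (y q.2) = c q.
Proof.
move=> x_inj y_inj.
pose V (z : 'I_n.+1 -> R) := Vandermonde n.+1 (\row_j z j).
have uV z : injective z -> V z \in unitmx.
  by move=> z_inj; apply: Vandermonde_unitmx => i j; rewrite !mxE => /z_inj.
(* A polynomial with coefficient matrix [C] has the nodal values (V x)^T C (V y). Since both
   Vandermonde matrices are invertible, this equation is solved for [C]. *)
pose C := invmx (V x)^T *m (\matrix_(i, j) c (i, j)) *m invmx (V y).
exists (fun s t => \sum_i \sum_j C i j * s ^+ i * t ^+ j); split; first by exists C.
case=> i j /=.
have <- : ((V x)^T *m C *m V y) i j = c (i, j).
  by rewrite /C !mulmxA mulmxV ?unitmx_tr ?uV// mul1mx mulmxKV ?uV// mxE.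
rewrite -mulmxA mxE; apply: eq_bigr => k _.
rewrite !mxE mulr_sumr; apply: eq_bigr => l _.
by rewrite !mxE mulrCA mulrA.
Qed.

Lemma hlen_gt0 (R : realType) (M : mesh R) (I : axis) (K : elt M) : 0 < hlen I K.
Proof. by case: I; rewrite subr_gt0 ?gx_incr ?gy_incr. Qed.

Lemma node_inj (R : realType) (M : mesh R) (n : nat) (Q : qrule R n) (I : axis)
    (K : elt M) : injective (qx Q) -> injective (node Q I K).
Proof.
move=> Q_inj i j /addrI /(mulIf (lt0r_neq0 (hlen_gt0 I K))).
have n2 : (2 : R)^-1 != 0 by rewrite invr_eq0 pnatr_eq0.
by move=> /(mulIf n2) /addrI /Q_inj.
Qed.

(** The space imposes no continuity across faces, so interpolants chosen independently on each
    element can be glued. *)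
Lemma in_V_interpolation (R : realType) (M : mesh R) (p : nat)
    (L : qrule R p.+1) (c : elt M -> 'I_p.+1 * 'I_p.+1 -> R) :
  injective (qx L) ->
  exists v : field M, in_V p v /\ forall K q, nval L L v K q = c K q.
Proof.
move=> L_inj.
have H K := is_Q_interpolation (c K) (node_inj (I := AX) (K := K) L_inj)
  (node_inj (I := AY) (K := K) L_inj).
have [v hv] := choice H.
by exists v; split=> K; [case: (hv K)|move=> q; exact: (hv K).2 q].
Qed.

(** * The GLL rule, and signs of the weights and damping exponents *)

Lemma is_GLL_inj (R : realType) (n : nat) (L : qrule R n.+1) :
  is_GLL L -> injective (qx L).
Proof.
case=> L_incr _ _ i j ij.
case: (ltngtP i j) => [/L_incr|/L_incr|]; rewrite ?ij ?ltxx//.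
exact: ord_inj.
Qed.

(* This needs no discussion of the zeros of [legendre R n]: a vanishing
   denominator makes the GLL weight 0. *)
Lemma nweight_ge0 (R : realType) (M : mesh R) (n : nat) (L : qrule R n.+1)
    (K : elt M) q : is_GLL L -> 0 <= nweight L L K q.
Proof.
case=> _ _ L_w.
have w0 i : 0 <= qw L i by rewrite L_w divr_ge0// mulr_ge0// sqr_ge0.
by rewrite !mulr_ge0// ltW// hlen_gt0.
Qed.

Lemma normf_sqr (R : realType) (M : mesh R) (F : vfield M) K x y :
  normf F K x y ^+ 2 = dotf F F K x y.
Proof. by rewrite sqr_sqrtr// sumr_ge0// => d _; rewrite -expr2 sqr_ge0. Qed.

Lemma bigmax0_ge0 (R : realType) (I : Type) (r : seq I) (P : pred I) (F : I -> R) :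
  0 <= \big[Num.max/0]_(i <- r | P i) F i.
Proof.
by elim/big_rec : _ => // i x _ x0; rewrite le_max x0 orbT.
Qed.

(** The maxima in [lambdaM] and [sigmau] start from 0, so they are nonnegative whatever their
    entries, even where [devmaxu] vanishes. *)
Lemma Theta_ge0 (R : realType) (M : mesh R) (p : nat) (L : qrule R p.+1) skip
    (rho : field M) (u B : vfield M) (l : nat) (K : elt M) :
  0 <= Theta L skip rho u B l K.
Proof.
have H I : 0 <= lambdaM L rho u B I K * \sum_(r < l.+1) sigmau skip r I K u.
  rewrite mulr_ge0 ?sumr_ge0//; last by move=> r _; exact: bigmax0_ge0.
  by rewrite mulr_ge0 ?bigmax0_ge0// divr_ge0// ltW// hlen_gt0.
by rewrite addr_ge0.
Qed.

Lemma damping_sqr_le1 (R : realType) (M : mesh R) (p : nat) (L : qrule R p.+1) skip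
    (sM tau : R) (rho : field M) (u B : vfield M) (l : nat) (K : elt M) :
  0 <= sM -> 0 <= tau -> damping L skip sM tau rho u B l K ^+ 2 <= 1.
Proof.
move=> sM0 tau0; rewrite expr_le1 ?expR_ge0// -expR0 ler_expR oppr_le0.
by rewrite !mulr_ge0 ?Theta_ge0.
Qed.

Lemma velocity_OE_energy_le (R : realType) (M : mesh R) (p : nat) (L : qrule R p.+1)
    skip (sM tau : R) (rho : field M) (B : vfield M) (em : field M) (um : vfield M)
    (ep : field M) (up : vfield M) K q :
  0 <= sM -> 0 <= tau -> velocity_OE L skip sM tau rho B em um ep up ->
  nval L L em K q <= nval L L ep K q.
Proof.
move=> sM0 tau0 [_ _ _ ->]; rewrite lerDl mulr_ge0 ?invr_ge0// sumr_ge0// => l _.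
by rewrite mulr_ge0 ?sqr_ge0// subr_ge0 damping_sqr_le1.
Qed.

(** * The discrete entropy in nodal values and its time derivative *)

Lemma entSE (R : realType) (M : mesh R) (n : nat) (L : qrule R n) (gamma : R)
    (rho e : field M) :
  entS L gamma rho e = \sum_(K : elt M) \sum_(q : 'I_n * 'I_n)
    nweight L L K q * nval L L rho K q *
      (ln ((gamma - 1) * nval L L rho K q * nval L L e K q)
       - gamma * ln (nval L L rho K q)).
Proof.
apply: eq_bigr => K _; apply: eq_bigr => q _.
(* Past the weight, the sides differ only by the value 1 of the constant test field. *)
by rewrite -mulrA; congr (_ * _); exact: mulr1.
Qed.

Lemma entE_le (R : realType) (M : mesh R) (n : nat) (L : qrule R n) (gamma : R)
    (rho e1 e2 : field M) :
  1 < gamma -> entS L gamma rho e1 <= entS L gamma rho e2 ->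
  entE L gamma rho e2 <= entE L gamma rho e1.
Proof.
by move=> g1 S12; rewrite ler_pM2r ?invr_gt0 ?subr_gt0// lerN2.
Qed.

Lemma is_derive_entS (R : realType) (M : mesh R) (n : nat) (L : qrule R n)
    (gamma : R) (rho : field M) (e : R -> field M) (t : R) :
  1 < gamma -> nodal_pos L rho -> nodal_pos L (e t) -> t_derivable e t ->
  is_derive t (1 : R) (fun s => entS L gamma rho (e s))
    (\sum_(K : elt M) \sum_(q : 'I_n * 'I_n) nweight L L K q *
      (nval L L rho K q * nval L L (dt e t) K q / nval L L (e t) K q)).
Proof.
move=> g1 rho0 e0 de; under eq_fun do rewrite entSE.
apply: is_derive_bigsum => K; apply: is_derive_bigsum => q.
set r := nval L L rho K q.
(* The nodes do not move, so sampling at a node commutes with the time derivative. *)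
have eK : is_derive t (1 : R) (fun s => nval L L (e s) K q) (nval L L (dt e t) K q).
  by rewrite /nval /dt derive1E; apply/derivableP/de.
have c0 : 0 < (gamma - 1) * r by rewrite mulr_gt0 ?subr_gt0 ?rho0.
have lnK := is_derive_ln_scale c0 (e0 K q) eK.
(* The density is fixed in time, so gamma ln [r] contributes derivative 0. *)
apply: (is_derive_eq (is_deriveZ (nweight L L K q * r)
  (is_deriveB lnK (is_derive_cst (gamma * ln r) _ _)))).
by rewrite subr0 /GRing.scale/= !mulrA.
Qed.

(* [mulf] alone would be the multiplication of fractions. *)
Lemma ohmic_production (R : realType) (M : mesh R) (p : nat) (L : qrule R p.+1)
    (rho e edot : field M) (eta : elt M -> R) (J : vfield M) :
  injective (qx L) ->
  (forall v, in_V p v ->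
    ipV L (Defs.mulf rho edot) v = ipV L (Defs.mulf (constf eta) (dotf J J)) v) ->
  \sum_(K : elt M) \sum_(q : 'I_p.+1 * 'I_p.+1) nweight L L K q *
    (nval L L rho K q * nval L L edot K q / nval L L e K q) =
  \sum_(K : elt M) \sum_(q : 'I_p.+1 * 'I_p.+1) nweight L L K q *
    (eta K * nval L L (normf J) K q ^+ 2 / nval L L e K q).
Proof.
move=> L_inj energy.
have [v [vV vE]] := in_V_interpolation (fun K q => (nval L L e K q)^-1) L_inj.
(* The quadrature samples [v] only at the interpolation nodes, so [v] replaces 1/e exactly although
   1/e need not be a polynomial. *)
transitivity (ipV L (Defs.mulf rho edot) v).
  by apply: eq_bigr => K _; apply: eq_bigr => q _; rewrite -vE.
rewrite energy//; apply: eq_bigr => K _; apply: eq_bigr => q _.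
by rewrite -vE [in RHS]/nval normf_sqr.
Qed.

Theorem theorem5 (R : realType) (M : mesh R) (p m : nat)
    (hp : (1 <= p)%N) (hm : m = p.-1 \/ m = p)
    (gamma : R) (hgamma : 1 < gamma)
    (Lp : qrule R p.+1) (hLp : is_GLL Lp)
    (Gm : qrule R m.+1) (hGm : is_GL Gm)
    (Lm : qrule R m.+2) (hLm : is_GLL Lm)
    (rho : field M) (hrhoV : in_V p rho) (hrho : nodal_pos Lp rho) :
  (forall (eta : elt M -> R) (heta : forall K, 0 <= eta K)
      (t0 t1 : R) (u B : R -> vfield M) (e : R -> field M) (J E : R -> vfield M)
      (hsol : forall t, t0 < t < t1 ->
        mv_system Lp Gm Lm rho (constf eta) u B e J E t)
      (he : forall t, t0 < t < t1 -> nodal_pos Lp (e t)),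
    (forall t : R, t0 < t < t1 ->
      let ohmic := \sum_(K : elt M) \sum_(q : 'I_p.+1 * 'I_p.+1)
        nweight Lp Lp K q *
          (eta K * nval Lp Lp (normf (J t)) K q ^+ 2 / nval Lp Lp (e t) K q) in
      is_derive t (1 : R) (fun s : R => entS Lp gamma rho (e s)) ohmic
      /\ 0 <= ohmic)
    /\ (forall s t : R, t0 < s < t1 -> t0 < t < t1 -> s <= t ->
         entS Lp gamma rho (e s) <= entS Lp gamma rho (e t)
         /\ entE Lp gamma rho (e t) <= entE Lp gamma rho (e s)))
  /\
  (forall (skip : axis -> elt M -> field M -> bool) (hskip : skip_rule skip)
      (sM tau : R) (hsM : 0 <= sM) (htau : 0 < tau)
      (B : vfield M) (hB : in_B m B)
      (em : field M) (um : vfield M) (ep : field M) (up : vfield M)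
      (hemV : in_V p em) (humX : in_X p um) (hem : nodal_pos Lp em)
      (hOE : velocity_OE Lp skip sM tau rho B em um ep up),
    let gain := \sum_(K : elt M) \sum_(q : 'I_p.+1 * 'I_p.+1)
      nweight Lp Lp K q * nval Lp Lp rho K q *
        ln (nval Lp Lp ep K q / nval Lp Lp em K q) in
    [/\ entS Lp gamma rho ep - entS Lp gamma rho em = gain,
        0 <= gain,
        entS Lp gamma rho em <= entS Lp gamma rho ep
      & entE Lp gamma rho ep <= entE Lp gamma rho em]).
Proof.
have L_inj := is_GLL_inj hLp.
have w0 K q := nweight_ge0 K q hLp.
split.
  move=> eta heta t0 t1 u B e J E hsol he.
  pose ohmic t := \sum_(K : elt M) \sum_(q : 'I_p.+1 * 'I_p.+1)
    nweight Lp Lp K q *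
      (eta K * nval Lp Lp (normf (J t)) K q ^+ 2 / nval Lp Lp (e t) K q).
  have ohmic_ge0 t : t0 < t < t1 -> 0 <= ohmic t.
    move=> tI; apply: sumr_ge0 => K _; apply: sumr_ge0 => q _.
    by rewrite mulr_ge0// divr_ge0 ?(ltW (he _ tI K q))// mulr_ge0// sqr_ge0.
  have dS t : t0 < t < t1 ->
      is_derive t (1 : R) (fun s => entS Lp gamma rho (e s)) (ohmic t).
    move=> tI; have sys := hsol t tI.
    rewrite /ohmic -(ohmic_production (e t) L_inj (mv_energy sys)).
    exact: is_derive_entS hgamma hrho (he t tI) (mv_de sys).
  split=> [t tI|s t sI tI st]; first by split; [exact: dS|exact: ohmic_ge0].
  have S_le := is_derive_ge0_homo dS ohmic_ge0 sI tI st.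
  by split=> //; exact: entE_le.
move=> skip hskip sM tau hsM htau B hB em um ep up hemV humX hem hOE gain.
have e_le K q := velocity_OE_energy_le K q hsM (ltW htau) hOE.
(* Positivity after the map is inherited from the state before it; the logarithm laws below rely on
   it. *)
have hep K q : 0 < nval Lp Lp ep K q := lt_le_trans (hem K q) (e_le K q).
have gainE : entS Lp gamma rho ep - entS Lp gamma rho em = gain.
  rewrite !entSE -sumrB; apply: eq_bigr => K _; rewrite -sumrB.
  apply: eq_bigr => q _; rewrite -mulrBr opprB addrA subrK.
  have c0 : 0 < (gamma - 1) * nval Lp Lp rho K q.
    by rewrite mulr_gt0 ?subr_gt0 ?hrho.
  (* The common factor (gamma - 1) rho is split off both logarithms and cancels, leaving the
     logarithm of the energy ratio. *)
  rewrite (lnM (y := nval _ _ ep _ _)) ?(lnM (y := nval _ _ em _ _)) ?posrE//.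
  by rewrite ln_div ?posrE// opprD addrACA subrr add0r.
have gain_ge0 : 0 <= gain.
  apply: sumr_ge0 => K _; apply: sumr_ge0 => q _.
  by rewrite mulr_ge0 ?ln_ge0 ?ler_pdivlMr ?mul1r// mulr_ge0// ltW ?hrho.
have S_le : entS Lp gamma rho em <= entS Lp gamma rho ep.
  by rewrite -subr_ge0 gainE.
by split=> //; exact: entE_le.
Qed.
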